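(* Let $\mathcal X=\{0,1\}$, let $X\sim\mathcal B(\rho)$ with $\rho\in(0,\tfrac12]$, and let $\Delta$ be the Hamming distortion $\Delta(x,\hat x)=1_{\{x\ne\hat x\}}$. Define $$\phi(D):=\inf_{p_{\hat X|X}}\{I(X;\hat X):\mathbb E[\Delta(X,\hat X)]\le D,\ p_{\hat X}=p_X\},$$ with $\hat X\in\{0,1\}$. Define $\varphi(D)$ as the infimum of $\max\{I(X;U),I(\hat X;U)\}$ over Polish spaces $\mathcal U$ and kernels $p_{U\hat X|X}$ with $\hat X\in\{0,1\}$, subject to: - $\mathbb E[\Delta(X,\hat X)]\le D$; - $X\leftrightarrow U\leftrightarrow\hat X$ is a Markov chain; - $p_{\hat X}=p_X$. Then for $D\in[0,2\rho(1-\rho))$, $$\phi(D)=2H_b(\rho)+\tfrac{2-2\rho-D}{2}\log\tfrac{2-2\rho-D}{2}+D\log\tfrac D2+\tfrac{2\rho-D}{2}\log\tfrac{2\rho-D}{2}$$ and $$\varphi(D)=H_b(\rho)-H_b\!\left(\tfrac{1-\sqrt{1-2D}}{2}\right),$$ while $\phi(D)=\varphi(D)=0$ for $D\ge2\rho(1-\rho)$.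
   Context: $\mathcal B(\rho)$ is the Bernoulli distribution with $\mathbb P(X=1)=\rho$. $H_b(a)=-a\log a-(1-a)\log(1-a)$ is the binary entropy function, with the convention $0\log0=0$. Logarithms are base 2. *)

(* Defs.v *)
From HB Require Import structures.
From mathcomp Require Import all_boot all_order all_algebra.
From mathcomp Require Import all_classical all_reals all_analysis.
Set Implicit Arguments. Unset Strict Implicit. Unset Printing Implicit Defensive.
Import Order.TTheory GRing.Theory Num.Theory.
Local Open Scope classical_set_scope.
Local Open Scope ring_scope.

Section InfoDefs.
Variable R : realType.

Definition log2 (x : R) : R := ln x / ln 2.

(* a * log2 b, with the convention 0 * log 0 = 0 (term vanishes when a = 0) *)
Definition xlg (a b : R) : R := if a == 0 then 0 else a * log2 b.

Definition Hb (a : R) : R := - xlg a a - xlg (1 - a) (1 - a).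

Definition mi_fin (I J : finType) (P : I -> J -> R) : R :=
  \sum_(i : I) \sum_(j : J)
     xlg (P i j) (P i j / ((\sum_(j' : J) P i j') * (\sum_(i' : I) P i' j))).

Definition pX (rho : R) (x : bool) : R := if x then rho else 1 - rho.

Definition hamming (x y : bool) : R := if x == y then 0 else 1.

(* a test channel is a stochastic matrix W x xh = p_{Xhat|X}(xh|x) *)
Definition stoch2 (W : bool -> bool -> R) : Prop :=
  (forall x y, 0 <= W x y) /\ (forall x, W x false + W x true = 1).

Definition pXXh (rho : R) (W : bool -> bool -> R) (x xh : bool) : R :=
  pX rho x * W x xh.

Definition phi (rho D : R) : \bar R :=
  ereal_inf [set v : \bar R | exists W : bool -> bool -> R,
    [/\ stoch2 W,
        \sum_(x : bool) \sum_(xh : bool) pXXh rho W x xh * hamming x xh <= D,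
        (forall xh, \sum_(x : bool) pXXh rho W x xh = pX rho xh) &
        v = (mi_fin (pXXh rho W))%:E]].

Section GeneralU.
Context {d : measure_display} {U : measurableType d}.

Definition fin_partition (n : nat) (A : 'I_n -> set U) : Prop :=
  [/\ (forall k, measurable (A k)),
      (forall k l, k != l -> A k `&` A l = set0) &
      \bigcup_(k in setT) A k = setT].

(* Mutual information between a {0,1}-valued variable Y and U, given the joint
   law J y A = P(Y = y, U \in A), defined (Dobrushin / Gelfand-Yaglom-Perez)
   as the supremum over finite measurable partitions of U of the discrete
   mutual information of the quantized pair. *)
Definition mi_bin_gen (J : bool -> set U -> R) : \bar R :=
  ereal_sup [set v : \bar R | exists (n : nat) (A : 'I_n -> set U),
     fin_partition A /\ v = (mi_fin (fun y (k : 'I_n) => J y (A k)))%:E].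

(* Markov chain X -> U -> Xhat: p_{U Xhat|X}(du, xh | x) = mu_x(du) p_{Xhat|U}(xh|u),
   where mu_x = p_{U|X=x} and g u = p_{Xhat|U}(1|u). *)
Definition gb (g : U -> R) (b : bool) (u : U) : R := if b then g u else 1 - g u.

Definition pXXhU (rho : R) (mu0 mu1 : probability U R) (g : U -> R)
    (x b : bool) (A : set U) : R :=
  pX rho x * fine (\int[if x then mu1 else mu0]_(u in A) (gb g b u)%:E)%E.

Definition pXU (rho : R) (mu0 mu1 : probability U R) (x : bool) (A : set U) : R :=
  pX rho x * fine ((if x then mu1 else mu0) A).

Definition pXhU (rho : R) (mu0 mu1 : probability U R) (g : U -> R)
    (b : bool) (A : set U) : R :=
  \sum_(x : bool) pXXhU rho mu0 mu1 g x b A.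

Definition admissible (rho D : R) (mu0 mu1 : probability U R) (g : U -> R) : Prop :=
  [/\ measurable_fun setT g,
      (forall u, 0 <= g u <= 1),
      \sum_(x : bool) \sum_(b : bool)
          pXXhU rho mu0 mu1 g x b setT * hamming x b <= D &
      (forall b, pXhU rho mu0 mu1 g b setT = pX rho b)].

Definition objective (rho : R) (mu0 mu1 : probability U R) (g : U -> R) : \bar R :=
  Order.max (mi_bin_gen (pXU rho mu0 mu1)) (mi_bin_gen (pXhU rho mu0 mu1 g)).

End GeneralU.

(* Polish space: a complete metric space (Hausdorff complete pseudometric
   space) having a countable dense subset; it carries its Borel sigma-algebra *)
Definition polish (T : completePseudoMetricType R) : Prop :=
  hausdorff_space T /\ exists S : set T, countable S /\ dense S.

Definition borel_of (T : completePseudoMetricType R) := g_sigma_algebraType (@open T).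

Definition varphi (rho D : R) : \bar R :=
  ereal_inf [set v : \bar R | exists (T : completePseudoMetricType R),
    polish T /\
    exists (mu0 mu1 : probability (borel_of T) R) (g : borel_of T -> R),
      admissible rho D mu0 mu1 g /\ v = objective rho mu0 mu1 g].

End InfoDefs.

(* Main.v *)
(* A coupling of two [B(rho)] variables is determined by its off-diagonal mass [b];
   Gibbs' inequality against the coupling of mass [D / 2] shows that its mutual
   information decreases in [b] up to the independent coupling [b = rho (1 - rho)],
   which gives [phi].

   For [varphi], write [s = 1 - 2 P(X = 1 | U)] and [t = 1 - 2 P(Xhat = 1 | U)], so that
   [E[s t] = 1 - 2 P(X <> Xhat)].  The entropy [Hb p] is a concave decreasing function of
   [(1 - 2 p)^2], and its tangent at [a], where [2 a (1 - a) = D], combined with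
   [s t <= (s^2 + t^2) / 2] bounds [(I(X; U) + I(Xhat; U)) / 2] from below by
   [Hb rho - Hb a].  For a general [U] the bound is applied to the finite partition of
   [U] by the value of [P(Xhat = 1 | U)], up to an error vanishing with the mesh.  At
   [D = 0] the tangent is vertical and one lets [a] tend to [0].  Equality holds for a
   binary [U] observed through two binary symmetric channels. *)
Require Import Defs.
From HB Require Import structures.
From mathcomp Require Import all_boot all_order all_algebra.
From mathcomp Require Import all_classical all_reals all_analysis.
From mathcomp Require Import measurable_realfun ring lra.
Set Implicit Arguments.
Unset Strict Implicit.
Unset Printing Implicit Defensive.
Import Order.TTheory GRing.Theory Num.Theory.
Import numFieldNormedType.Exports.
Local Open Scope classical_set_scope.
Local Open Scope ring_scope.

(** * Binary entropy: the tangent inequality, Gibbs' inequality and the log-sum inequality *)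

Section Entropy.
Variable R : realType.
Implicit Types a b e p r t w x y z : R.

Lemma ln2_gt0 : 0 < ln 2 :> R.
Proof. by apply: ln_gt0; lra. Qed.

Lemma xlgE x y : xlg x y = x * ln y / ln 2.
Proof. by rewrite /xlg /log2; case: eqVneq => [->|_]; rewrite ?mul0r ?mulrA. Qed.

Lemma HbE p : Hb p = (- (p * ln p) - (1 - p) * ln (1 - p)) / ln 2.
Proof. by rewrite /Hb !xlgE; ring. Qed.

Lemma Hb_symm p : Hb (1 - p) = Hb p.
Proof. by rewrite !HbE subKr; ring. Qed.

Lemma is_derive_le (f f' : R -> R) x y : x <= y ->
  (forall z, x <= z <= y -> is_derive z 1 f (f' z)) ->
  (forall z, x <= z <= y -> 0 <= f' z) -> f x <= f y.
Proof.
move=> xy df f'0.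
have [||z zxy E] := @MVT_segment R f f' x y xy.
- by move=> z; rewrite in_itv/= => /andP[/ltW xz /ltW zy]; apply: df; rewrite xz.
- apply: derivable_within_continuous => z; rewrite in_itv/= => /df dfz.
  exact: ex_derive.
rewrite -subr_ge0 E mulr_ge0 ?subr_ge0//.
by apply: f'0; move: zxy; rewrite in_itv.
Qed.

(** The derivative of the binary entropy, in nats. *)
Let L p := ln (1 - p) - ln p.

Let dln1B p : p < 1 -> is_derive p 1 (fun z => ln (1 - z)) (- (1 - p)^-1).
Proof.
move=> p1; have p1' : 0 < 1 - p by lra.
have d1 : is_derive p 1 (fun z => 1 - z : R) (-1).
  by apply: is_derive_eq; ring.
have d2 := is_derive1_ln p1'.
have -> : - (1 - p)^-1 = (1 - p)^-1 * -1 by ring.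
exact: (@is_derive1_comp _ (@ln R) (fun z => 1 - z) p _ _ d2 d1).
Qed.

Let dL p : 0 < p < 1 -> is_derive p 1 L (- (p * (1 - p))^-1).
Proof.
move=> /andP[p0 p1]; have := dln1B p1; have := is_derive1_ln p0 => d1 d2.
apply: is_derive_eq; field.
by rewrite !lt0r_neq0// subr_gt0.
Qed.

(** The difference of the two sides vanishes at [1 / 2], and its derivative is a perfect square. *)
Let L_le p : 0 < p <= 1 / 2 -> 2 * L p <= p^-1 - (1 - p)^-1.
Proof.
move=> /andP[p0 p2].
pose M z := 2 * L z - (z^-1 - (1 - z)^-1).
have M2 : M (1 / 2) = 0.
  have h : 1 - 1 / 2 = 1 / 2 :> R by lra.
  by rewrite /M /L h !subrr mulr0 subrr.
rewrite -subr_le0 -/(M p) -M2.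
apply: (@is_derive_le M (fun z => (z^-1 - (1 - z)^-1) ^+ 2)) => // z /andP[pz z2];
  last exact: sqr_ge0.
have z01 : 0 < z < 1 by apply/andP; split; lra.
have zn0 : z != 0 by apply: lt0r_neq0; lra.
have zn1 : 1 - z != 0 by apply: lt0r_neq0; lra.
have d1 := dL z01.
have d2 : is_derive z 1 (fun z => z^-1) (- z^-2 * 1) by apply: is_deriveV.
have d3 : is_derive z 1 (fun z => (1 - z)^-1) (- (1 - z)^-2 * -1).
  have d : is_derive z 1 (fun z => 1 - z : R) (-1) by apply: is_derive_eq; ring.
  exact: (@is_deriveV _ (fun z => 1 - z)).
apply: is_derive_eq; rewrite -[_ *: _]/(_ * _).
by field; rewrite zn0 zn1.
Qed.

(** By [L_le] the derivative of the quotient is nonpositive. Up to the factor [-1 / 4] the quotient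
    is the derivative of the entropy with respect to [(1 - 2 * p) ^+ 2], so this monotonicity is the
    concavity in that variable. *)
Let L_ratio p a : 0 < p -> p <= a -> a < 1 / 2 ->
  L a / (1 - 2 * a) <= L p / (1 - 2 * p).
Proof.
move=> p0 pa a2; rewrite -lerN2.
pose r z := - (L z / (1 - 2 * z)).
apply: (@is_derive_le r (fun z => (z^-1 - (1 - z)^-1 - 2 * L z) / (1 - 2 * z) ^+ 2))
  => // z /andP[pz za]; last first.
  by rewrite divr_ge0 ?sqr_ge0// subr_ge0; apply: L_le; apply/andP; split; lra.
have z01 : 0 < z < 1 by apply/andP; split; lra.
have zn0 : z != 0 by apply: lt0r_neq0; lra.
have zn1 : 1 - z != 0 by apply: lt0r_neq0; lra.
have zn2 : 1 - 2 * z != 0 by apply: lt0r_neq0; lra.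
have d1 := dL z01.
have d3 : is_derive z 1 (fun z => (1 - 2 * z)^-1) (- (1 - 2 * z)^-2 * -2).
  have d : is_derive z 1 (fun z => 1 - 2 * z : R) (-2).
    by apply: is_derive_eq; rewrite -?[_ *: _]/(_ * _); ring.
  exact: (@is_deriveV _ (fun z => 1 - 2 * z)).
apply: is_derive_eq; rewrite -![_ *: _]/(_ * _).
by field; rewrite zn0 zn1 zn2.
Qed.

(* Minus the derivative, at [p = a] and in nats, of [Hb p] seen as a function of
   [(1 - 2 * p) ^+ 2]. *)
Definition slope a := (ln (1 - a) - ln a) / (1 - 2 * a) / 4.

(** The entropy in nats minus the linear part of its tangent at [a]: the tangent inequality says
    that [F a] is maximal at [a]. *)
Let F a p := - (p * ln p) - (1 - p) * ln (1 - p) + slope a * (1 - 2 * p) ^+ 2.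

Let dF a p : 0 < p < 1 -> is_derive p 1 (F a) (L p - 4 * slope a * (1 - 2 * p)).
Proof.
move=> /andP[p0 p1]; have := dln1B p1; have := is_derive1_ln p0 => d1 d2.
apply: is_derive_eq; rewrite -![_ *: _]/(_ * _) /L.
field.
by rewrite !lt0r_neq0// subr_gt0.
Qed.

Lemma slope_ge0 a : 0 < a < 1 / 2 -> 0 <= slope a.
Proof.
move=> /andP[a0 a2]; rewrite /slope !divr_ge0//; last by lra.
by rewrite subr_ge0 ler_ln ?posrE//; lra.
Qed.

Let slopeE a : a < 1 / 2 -> 4 * slope a = L a / (1 - 2 * a).
Proof. by move=> a2; rewrite /slope /L; field; apply: lt0r_neq0; lra. Qed.

Let F_symm a p : F a (1 - p) = F a p.
Proof. by rewrite /F subKr; ring. Qed.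

(** By [L_ratio], [F a] increases up to [a] and decreases from [a] to [1 / 2]. *)
Let F_le_half a p : 0 < a < 1 / 2 -> 0 < p <= 1 / 2 -> F a p <= F a a.
Proof.
move=> /andP[a0 a2] /andP[p0 p2].
have [pa|/ltW ap] := leP p a.
  apply: (is_derive_le pa) => z /andP[pz za]; first by apply: dF; apply/andP; split; lra.
  have z2 : 0 < 1 - 2 * z by lra.
  by rewrite slopeE// subr_ge0 -ler_pdivlMr//; apply: L_ratio => //; lra.
rewrite -lerN2.
apply: (@is_derive_le (fun p => - F a p) (fun p => - (L p - 4 * slope a * (1 - 2 * p))))
  => // z /andP[az zp].
  have := @dF a z; have -> : 0 < z < 1 by apply/andP; split; lra.
  by move=> /(_ isT) d; apply: is_deriveN.
rewrite oppr_ge0 subr_le0.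
have [z2|z2] := ltP z (1 / 2).
  rewrite slopeE// -ler_pdivrMr; last by lra.
  by apply: L_ratio => //; lra.
have -> : z = 1 / 2 by lra.
by rewrite /L (_ : 1 - 1 / 2 = 1 / 2); lra.
Qed.

(** The left side is [F a 0]. The derivative does not reach this endpoint, so the bound is obtained
    from small [p > 0]. *)
Let F_le0 a : 0 < a < 1 / 2 -> slope a <= F a a.
Proof.
move=> a02; have /andP[a0 a2] := a02; apply/ler_addgt0Pr => e e0.
have c0 := slope_ge0 a02.
(* Replacing [(1 - 2 * p) ^+ 2] by 1 costs at most [4 * p * slope a], which this choice keeps below
   [e]. *)
pose p := Num.min a (e / (4 * (slope a + 1))).
have p0 : 0 < p by rewrite lt_min a0 divr_gt0//; lra.
have pa : p <= a by rewrite ge_min lexx.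
have pe : p * (4 * (slope a + 1)) <= e.
  by rewrite -ler_pdivlMr ?ge_min ?lexx ?orbT//; lra.
have : F a p <= F a a by apply: F_le_half => //; apply/andP; split; lra.
have : 0 <= - (p * ln p) by rewrite oppr_ge0 mulr_ge0_le0 ?ln_le0//; lra.
have : (1 - p) * ln (1 - p) <= 0 by rewrite mulr_ge0_le0 ?ln_le0//; lra.
have := sqr_ge0 p; have : 0 <= slope a * p ^+ 2 by rewrite mulr_ge0 ?sqr_ge0.
by rewrite /F; nra.
Qed.

Let F_le a p : 0 < a < 1 / 2 -> 0 <= p <= 1 -> F a p <= F a a.
Proof.
move=> a02; wlog p2 : p / p <= 1 / 2 => [H|] /andP[p0 p1].
  have [p2|p2] := leP p (1 / 2); first by apply: H => //; rewrite p0.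
  by rewrite -F_symm; apply: H; [lra|rewrite subr_ge0 p1 gerBl p0].
move: p0; rewrite le_eqVlt => /predU1P[<-|p0]; last by apply: F_le_half => //; rewrite p0.
by have := F_le0 a02; rewrite /F mul0r mulr0 !subr0 ln1; lra.
Qed.

(* [Hb p] is a concave function of [(1 - 2 * p) ^+ 2]; this is its tangent at [a]. *)
Lemma Hb_le_tangent a p : 0 < a < 1 / 2 -> 0 <= p <= 1 ->
  Hb p <= Hb a + slope a / ln 2 * ((1 - 2 * a) ^+ 2 - (1 - 2 * p) ^+ 2).
Proof.
move=> a02 /(F_le a02); rewrite /F !HbE -subr_ge0 => FF.
have l2 := ln2_gt0.
rewrite -subr_ge0; set X := (X in 0 <= X).
set Y := (Y in 0 <= Y) in FF.
have -> : X = Y / ln 2 by rewrite /X /Y; field; apply: lt0r_neq0.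
by rewrite divr_ge0// ltW.
Qed.

(** For a cell on which a bit takes its two values with masses [x] and [y], this is minus the
    contribution of the cell to the conditional entropy of the bit. *)
Definition xlg_cell x y := xlg x (x / (x + y)) + xlg y (y / (x + y)).

Lemma xlg_cell_scale w p : xlg_cell (w * p) (w * (1 - p)) = - w * Hb p.
Proof.
have [->|w0] := eqVneq w 0; first by rewrite /xlg_cell !xlgE; ring.
rewrite /xlg_cell -mulrDr subrKC mulr1 !xlgE HbE.
have -> : w * p / w = p by rewrite mulrAC divff// mul1r.
have -> : w * (1 - p) / w = 1 - p by rewrite mulrAC divff// mul1r.
ring.
Qed.

(** The tangent bound, with the square of the bias [s = 1 - 2 * p] replaced by its minorant
    [2 * t * s - t ^+ 2]. The result is linear in the masses for fixed [t], which suits summation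
    over cells. *)
Lemma xlg_cell_ge a x y t : 0 < a < 1 / 2 -> 0 <= x -> 0 <= y ->
  slope a / ln 2 * (2 * t * (x - y) - t ^+ 2 * (x + y))
  - (x + y) * (Hb a + slope a / ln 2 * (1 - 2 * a) ^+ 2)
  <= xlg_cell x y.
Proof.
move=> a02 x0 y0; set c := slope a / ln 2; set w := x + y.
have c0 : 0 <= c by rewrite divr_ge0 ?slope_ge0// ltW// ln2_gt0.
have [w0|wn0] := eqVneq w 0.
  have -> : x = 0 by move: w0; rewrite /w; lra.
  have -> : y = 0 by move: w0; rewrite /w; lra.
  by rewrite w0 /xlg_cell !xlgE; nra.
have wp : 0 < w by rewrite lt_def wn0 /w; lra.
pose p := y / w.
have p01 : 0 <= p <= 1.
  by rewrite divr_ge0//= ?(ltW wp)// ler_pdivrMr// mul1r /w; lra.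
have yE : y = w * p by rewrite /p mulrC divfK.
have xE : x = w * (1 - p) by rewrite mulrBr mulr1 -yE /w; lra.
have -> : xlg_cell x y = - w * Hb p.
  by rewrite xE yE -[X in _ (w * X)](subKr 1) xlg_cell_scale Hb_symm.
have := Hb_le_tangent a02 p01; rewrite -/c => /(ler_wpM2l (ltW wp)).
have := mulr_ge0 (mulr_ge0 (ltW wp) c0) (sqr_ge0 (1 - 2 * p - t)).
have -> : x - y = w * (1 - 2 * p) by rewrite xE yE; ring.
set H := Hb p; set H' := Hb a; lra.
Qed.

(** This is [ln u <= u - 1] at [u = w * r / x]; the last hypothesis is absolute continuity. *)
Lemma gibbs x w r : 0 <= x -> 0 <= w -> 0 <= r -> (w * r = 0 -> x = 0) ->
  x * ln r <= x * ln (x / w) + w * r - x.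
Proof.
move=> x0 w0 r0 H.
move: x0; rewrite le_eqVlt => /predU1P[<-|x0].
  by rewrite !mul0r add0r subr0 mulr_ge0.
have wr : 0 < w * r.
  rewrite lt_def mulr_ge0// andbT; apply/eqP => /H xx; by rewrite xx ltxx in x0.
have wp : 0 < w by rewrite lt_def w0 andbT; apply/eqP => w00; rewrite w00 mul0r ltxx in wr.
have rp : 0 < r by rewrite lt_def r0 andbT; apply/eqP => w00; rewrite w00 mulr0 ltxx in wr.
have t0 : 0 < w * r / x by rewrite divr_gt0.
have : ln (1 + (w * r / x - 1)) <= w * r / x - 1 by apply: le_ln1Dx; lra.
rewrite subrKC => /(ler_wpM2l (ltW x0)).
rewrite !(ln_div, lnM) ?posrE//; have -> : x * (w * r / x - 1) = w * r - x.
  by field; apply: lt0r_neq0.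
lra.
Qed.

(** Gibbs' inequality for each pair against the merged ratio [r]; the linear corrections cancel in
    the sum. *)
Lemma log_sum x w x' w' : 0 <= x <= w -> 0 <= x' <= w' ->
  xlg (x + x') ((x + x') / (w + w')) <= xlg x (x / w) + xlg x' (x' / w').
Proof.
move=> /andP[x0 xw] /andP[x'0 x'w']; rewrite !xlgE.
set r := (x + x') / (w + w').
have r0 : 0 <= r by rewrite divr_ge0//; lra.
have rw : (w + w') * r = x + x'.
  rewrite /r; have [ww|ww] := eqVneq (w + w') 0; first by rewrite ww mul0r; lra.
  by rewrite mulrC divfK.
have rx : r = 0 -> x + x' = 0 by move=> r00; rewrite -rw r00 mulr0.
have h1 : x * ln r <= x * ln (x / w) + w * r - x.
  apply: gibbs => //; first by lra.
  by move/eqP; rewrite mulf_eq0 => /orP[/eqP ?|/eqP /rx ?]; lra.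
have h2 : x' * ln r <= x' * ln (x' / w') + w' * r - x'.
  apply: gibbs => //; first by lra.
  by move/eqP; rewrite mulf_eq0 => /orP[/eqP ?|/eqP /rx ?]; lra.
have l2 := ln2_gt0; rewrite -mulrDl ler_pM2r ?invr_gt0//.
lra.
Qed.

(** Data processing: merging two cells cannot raise the mutual information. *)
Lemma xlg_cell_add x y x' y' : 0 <= x -> 0 <= y -> 0 <= x' -> 0 <= y' ->
  xlg_cell (x + x') (y + y') <= xlg_cell x y + xlg_cell x' y'.
Proof.
move=> x0 y0 x'0 y'0; rewrite /xlg_cell (addrACA x) [leRHS]addrACA; apply: lerD; apply: log_sum;
  by rewrite ?x0 ?y0 ?x'0 ?y'0 ?lerDl ?lerDr.
Qed.

Lemma Hb_small e b : 0 < e -> 0 < b -> exists2 a, 0 < a < b & Hb a <= e.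
Proof.
move=> e0 b0; have l2 := ln2_gt0.
(* With [a = t ^+ 2], the bound [- ln t <= t^-1] makes the first entropy term at most [2 * t]; the
   second is at most [t ^+ 2 <= t], whence the 3. *)
pose t := Num.min (Num.min (1 / 2) (b / 2)) (e * ln 2 / 3).
have t0 : 0 < t by rewrite !lt_min !divr_gt0 ?mulr_gt0.
have t2 : t <= 1 / 2 by rewrite !ge_min lexx.
have tb : t <= b / 2 by rewrite !ge_min lexx orbT.
have te : t <= e * ln 2 / 3 by rewrite !ge_min lexx orbT.
exists (t ^+ 2); first by rewrite exprn_gt0//=; nra.
have t1 : 0 < 1 - t ^+ 2 by nra.
rewrite HbE ler_pdivrMr// lnXn// mulr2n.
have h1 : - ln t <= t^-1 by rewrite -lnV ?posrE// ltW// ln_sublinear// invr_gt0.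
have h2 : - ln (1 - t ^+ 2) <= (1 - t ^+ 2)^-1 - 1.
  rewrite -lnV ?posrE//.
  have := @le_ln1Dx _ ((1 - t ^+ 2)^-1 - 1); rewrite subrKC; apply.
  by have := invr_gt0 (1 - t ^+ 2); rewrite t1; lra.
have h3 : (1 - t ^+ 2) * - ln (1 - t ^+ 2) <= t ^+ 2.
  have := ler_wpM2l (ltW t1) h2.
  by rewrite mulrBr mulfV ?lt0r_neq0//; lra.
have h4 : t ^+ 2 * - ln t <= t.
  have := ler_wpM2l (sqr_ge0 t) h1.
  by rewrite expr2 mulfK ?lt0r_neq0.
by nra.
Qed.

End Entropy.

Lemma sum_bool (V : nmodType) (f : bool -> V) : \sum_(x : bool) f x = f true + f false.
Proof. by rewrite big_bool. Qed.

(** * Couplings of two bits with equal marginals, and the value of [phi] *)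

Section Binary.
Variables (R : realType) (rho : R).
Hypothesis rho02 : 0 < rho <= 1 / 2.
Implicit Types b c D : R.

Lemma xlg_div (x q : R) : 0 <= x -> 0 < q -> xlg x (x / q) = xlg x x - x * ln q / ln 2.
Proof.
rewrite le_eqVlt => /predU1P[<-|x0] q0; rewrite !xlgE; first by rewrite !mul0r subrr.
by rewrite ln_div ?posrE// mulrBr mulrBl.
Qed.

(* Mutual information of the pair with both marginals [pX rho] and mass [b] in
   each off-diagonal cell. *)
Definition mi_symm b :=
  2 * Hb rho + xlg (1 - rho - b) (1 - rho - b) + 2 * xlg b b + xlg (rho - b) (rho - b).

Lemma mi_fin_pXXh W : stoch2 W ->
  (forall xh, \sum_(x : bool) pXXh rho W x xh = pX rho xh) ->
  mi_fin (pXXh rho W) = mi_symm (rho * W true false).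
Proof.
have /andP[rho0 rho2] := rho02; have rho1 : 0 < 1 - rho by lra.
move=> [W0 W1] M; set b := rho * W true false.
have b0 : 0 <= b by rewrite mulr_ge0 ?W0// ltW.
have ptf : pXXh rho W true false = b by [].
have ptt : pXXh rho W true true = rho - b.
  by rewrite /pXXh/= -[in RHS](mulr1 rho) -(W1 true) /b; ring.
have pft : pXXh rho W false true = b.
  by have : _ = rho := M true; rewrite sum_bool ptt; lra.
have pff : pXXh rho W false false = 1 - rho - b.
  by have : _ = 1 - rho := M false; rewrite sum_bool ptf; lra.
have bl : 0 <= rho - b by rewrite -ptt mulr_ge0 ?W0// ltW.
have br : 0 <= 1 - rho - b by rewrite -pff mulr_ge0 ?W0//= ltW.
rewrite /mi_fin !sum_bool !ptt !ptf !pft !pff !subrK !subrKC.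
rewrite !xlg_div ?mulr_gt0// !lnM ?posrE//.
by rewrite /mi_symm HbE; ring.
Qed.

(** The factor after [b - c] is [ln 2] times the derivative of [mi_symm] at [c]. Gibbs' inequality
    on each cell puts [mi_symm] above its tangent at [c]. *)
Lemma mi_symm_le b c : 0 <= b <= rho -> 0 < c < rho ->
  0 <= (b - c) * (2 * ln c - ln (rho - c) - ln (1 - rho - c)) ->
  mi_symm c <= mi_symm b.
Proof.
have /andP[rho0 rho2] := rho02; have rho1 : 0 < 1 - rho by lra.
move=> /andP[b0 br] /andP[c0 cr] H.
have g (x r : R) : 0 <= x -> 0 < r -> x * ln r <= x * ln x + r - x.
  move=> x0 r0; have := @gibbs R x 1 r x0 ler01 (ltW r0).
  by rewrite invr1 !mulr1 mul1r; apply => r00; move: r0; rewrite r00 ltxx.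
have g1 := g b c b0 c0.
have g2 := g (rho - b) (rho - c) ltac:(lra) ltac:(lra).
have g3 := g (1 - rho - b) (1 - rho - c) ltac:(lra) ltac:(lra).
rewrite -subr_ge0 /mi_symm !xlgE.
set Y := (Y in 0 <= Y).
have -> : Y = (2 * (b * ln b) + (rho - b) * ln (rho - b)
    + (1 - rho - b) * ln (1 - rho - b) - (2 * (c * ln c) + (rho - c) * ln (rho - c)
    + (1 - rho - c) * ln (1 - rho - c))) / ln 2 by rewrite /Y; ring.
rewrite divr_ge0 ?(ltW (ln2_gt0 R))//.
lra.
Qed.

Lemma mi_symm_anti b c : 0 <= b <= c -> c < rho * (1 - rho) ->
  mi_symm c <= mi_symm b.
Proof.
have /andP[rho0 rho2] := rho02; have rho1 : 0 < 1 - rho by lra.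
move=> /andP[b0 bc] cr.
have [c0|cn0] := eqVneq c 0; first by rewrite (_ : b = c)//; lra.
have c0 : 0 < c by rewrite lt_def cn0; lra.
have crho : c < rho by nra.
apply: mi_symm_le; [apply/andP; split; lra|by rewrite c0|].
rewrite mulr_le0//; first by lra.
have p1 : 0 < rho - c by lra.
have p2 : 0 < 1 - rho - c by lra.
(* The product equals [rho * (1 - rho) - c + c ^+ 2], so this is [c <= rho * (1 - rho)]. *)
have : ln (c ^+ 2) <= ln ((rho - c) * (1 - rho - c)).
  by rewrite ler_ln ?posrE ?exprn_gt0 ?mulr_gt0//; nra.
by rewrite lnXn// lnM ?posrE// mulr2n; lra.
Qed.

(** The independent coupling is a critical point of [mi_symm]. *)
Let lnrr : 2 * ln (rho * (1 - rho)) - ln (rho - rho * (1 - rho))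
  - ln (1 - rho - rho * (1 - rho)) = 0.
Proof.
have /andP[rho0 rho2] := rho02; have rho1 : 0 < 1 - rho by lra.
have -> : rho - rho * (1 - rho) = rho * rho by ring.
have -> : 1 - rho - rho * (1 - rho) = (1 - rho) * (1 - rho) by ring.
by rewrite !lnM ?posrE//; ring.
Qed.

Lemma mi_symm_prod : mi_symm (rho * (1 - rho)) = 0.
Proof.
have /andP[rho0 rho2] := rho02; have rho1 : 0 < 1 - rho by lra.
rewrite /mi_symm !xlgE HbE.
have -> : rho - rho * (1 - rho) = rho * rho by ring.
have -> : 1 - rho - rho * (1 - rho) = (1 - rho) * (1 - rho) by ring.
by rewrite !lnM ?posrE//; ring.
Qed.

Lemma mi_symm_ge0 b : 0 <= b <= rho -> 0 <= mi_symm b.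
Proof.
have /andP[rho0 rho2] := rho02; have rho1 : 0 < 1 - rho by lra.
move=> b0; rewrite -mi_symm_prod; apply: mi_symm_le => //.
  by rewrite mulr_gt0//= gtr_pMr//; lra.
by rewrite lnrr mulr0.
Qed.

Lemma phi_le b D : 0 <= b <= rho -> 2 * b <= D -> (phi rho D <= (mi_symm b)%:E)%E.
Proof.
have /andP[rho0 rho2] := rho02; have rho1 : 0 < 1 - rho by lra.
move=> /andP[b0 br] bD; apply: ereal_inf_lbound => /=.
(* Flipping [x] with probability [b / pX rho x] puts mass [b] in each off-diagonal cell. *)
pose W (x xh : bool) := if x == xh then 1 - b / pX rho x else b / pX rho x.
have rn0 : rho != 0 by rewrite lt0r_neq0.
have r1n0 : 1 - rho != 0 by rewrite lt0r_neq0.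
have Wst : stoch2 W.
  split; last by case; rewrite /W/=; ring.
  have h1 : 0 <= b / rho by rewrite divr_ge0// ltW.
  have h2 : 0 <= b / (1 - rho) by rewrite divr_ge0// ltW.
  have h3 : b / rho <= 1 by rewrite ler_pdivrMr// mul1r.
  have h4 : b / (1 - rho) <= 1 by rewrite ler_pdivrMr// mul1r; lra.
  by case; case; rewrite /W/= ?subr_ge0.
have WM xh : \sum_(x : bool) pXXh rho W x xh = pX rho xh.
  by rewrite sum_bool /pXXh /W; case: xh => /=; field; rewrite ?rn0 ?r1n0.
exists W; split=> //.
  rewrite !sum_bool /pXXh /W /hamming/=.
  rewrite [leLHS](_ : _ = 2 * b)//; field; by rewrite rn0 r1n0.
rewrite mi_fin_pXXh//; congr (_ _)%:E.
by rewrite /W/=; field.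
Qed.

Lemma phi_ge D (v : R) :
  (forall b, 0 <= b <= rho -> 2 * b <= D -> v <= mi_symm b) -> (v%:E <= phi rho D)%E.
Proof.
have /andP[rho0 rho2] := rho02; have rho1 : 0 < 1 - rho by lra.
move=> H; apply: le_ereal_inf_tmp => _ [W [[W0 W1] WD WM ->]].
rewrite lee_fin mi_fin_pXXh//; apply: H.
  rewrite mulr_ge0 ?W0 ?(ltW rho0)//= ler_piMr ?(ltW rho0)//.
  by have := W1 true; have := W0 true true; lra.
move: WD; have := WM true; rewrite !sum_bool /pXXh /hamming/= => h.
have := W1 true => w1.
have : rho * (W true false + W true true) = rho by rewrite w1 mulr1.
lra.
Qed.

Lemma phiE D : 0 <= D < 2 * rho * (1 - rho) -> phi rho D = (mi_symm (D / 2))%:E.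
Proof.
have /andP[rho0 rho2] := rho02; have rho1 : 0 < 1 - rho by lra.
move=> /andP[D0 D1]; apply/eqP; rewrite eq_le; apply/andP; split.
  by apply: phi_le; [apply/andP; split; nra|lra].
apply: phi_ge => b /andP[b0 _] bD.
by apply: mi_symm_anti; [apply/andP; split; lra|lra].
Qed.

Lemma phi_eq0 D : 2 * rho * (1 - rho) <= D -> phi rho D = 0%:E.
Proof.
have /andP[rho0 rho2] := rho02; have rho1 : 0 < 1 - rho by lra.
move=> D1; apply/eqP; rewrite eq_le; apply/andP; split.
  rewrite -mi_symm_prod; apply: phi_le; last by lra.
  by rewrite mulr_ge0 ?(ltW rho0) ?(ltW rho1)//= ler_piMr ?(ltW rho0)//; lra.
by apply: phi_ge => b b0 _; apply: mi_symm_ge0.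
Qed.

End Binary.

(** The decomposition of mutual information as entropy minus conditional entropy. *)
Lemma mi_fin_bool (R : realType) (rho : R) (I : finType) (P : bool -> I -> R) :
  0 < rho < 1 -> (forall y k, 0 <= P y k) ->
  (forall y, \sum_k P y k = pX rho y) ->
  mi_fin P = Hb rho + \sum_k xlg_cell (P true k) (P false k).
Proof.
move=> /andP[rho0 rho1] P0 PM.
have p0 y : 0 < pX rho y by case: y; rewrite /pX ?subr_gt0.
have E y k : xlg (P y k) (P y k / ((\sum_j P y j) * \sum_z P z k)) =
    xlg (P y k) (P y k / (P true k + P false k)) - P y k * (ln (pX rho y) / ln 2).
  rewrite PM sum_bool !xlgE.
  have := P0 y k; rewrite le_eqVlt => /predU1P[<-|Pk]; first by rewrite !mul0r subrr.
  have w0 : 0 < P true k + P false k.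
    by move: (P0 true k) (P0 false k) Pk; case: y; lra.
  by rewrite !(ln_div, lnM) ?posrE ?mulr_gt0//; ring.
rewrite /mi_fin sum_bool; under eq_bigr do rewrite E.
under [in X in _ + X]eq_bigr do rewrite E.
rewrite !sumrB -!mulr_suml !PM /xlg_cell big_split/= HbE /=; ring.
Qed.

(** * Integrals of functions with values in the unit interval over finite partitions *)

Section Bounded.
Context (R : realType) {d : measure_display} {U : measurableType d}.
Variables (mu : probability U R) (g : U -> R).
Hypotheses (mg : measurable_fun setT g) (g01 : forall u, 0 <= g u <= 1).

Lemma unit_integrable A : measurable A -> mu.-integrable A (EFin \o g).
Proof.
move=> mA; apply: measurable_bounded_integrable => //.
- by rewrite (le_lt_trans (probability_le1 mu mA))// ltry.
- exact: measurable_funTS.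
- exists 1; split=> // M M1 u _ /=.
  by have /andP[g0 g1] := g01 u; rewrite ger0_norm// (le_trans g1)// ltW.
Qed.

Lemma Rintegral_onem A : measurable A ->
  \int[mu]_(u in A) (1 - g u) = fine (mu A) - \int[mu]_(u in A) g u.
Proof.
move=> mA; rewrite RintegralB//; last exact: unit_integrable.
  by rewrite Rintegral_cst// mul1r.
exact: finite_measure_integrable_cst.
Qed.

Lemma Rintegral_bounds A l h : measurable A -> (forall u, A u -> l <= g u <= h) ->
  l * fine (mu A) <= \int[mu]_(u in A) g u <= h * fine (mu A).
Proof.
move=> mA H; have ig := unit_integrable mA.
rewrite -!(Rintegral_cst mu mA); apply/andP; split; apply: le_Rintegral => //;
  do ?exact: finite_measure_integrable_cst; by move=> u /H /andP[].
Qed.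

Lemma Rintegral_partition n (A : 'I_n -> set U) : fin_partition A ->
  \sum_k \int[mu]_(u in A k) g u = \int[mu]_u g u.
Proof.
move=> [mA dA cA]; rewrite /Rintegral.
have -> : [set: U] = \big[setU/set0]_(k <- enum 'I_n) A k.
  rewrite -cA -bigcup_seq; apply: eq_bigcupl; split=> k _ //=.
  by rewrite mem_enum.
rewrite integral_bigsetU_EFin//.
- rewrite big_enum/= -[LHS]/(fine (_%:E)) -sumEFin; congr fine.
  apply: eq_bigr => k _; rewrite fineK//.
  by apply: integrable_fin_num => //; exact: unit_integrable.
- exact: enum_uniq.
- by apply/trivIsetP => i j _ _; exact: dA.
- exact/measurable_EFinP/measurable_funTS.
Qed.

End Bounded.

Lemma mass_partition (R : realType) (d : measure_display) (U : measurableType d)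
    (mu : probability U R) n (A : 'I_n -> set U) : fin_partition A ->
  \sum_k fine (mu (A k)) = 1.
Proof.
move=> pA; have [mA _ _] := pA.
have c01 (u : U) : 0 <= (cst 1 u : R) <= 1 by rewrite /= ler01 lexx.
have := Rintegral_partition mu (measurable_cst _) c01 pA.
have -> : \int[mu]_u (cst 1 u : R) = 1
  by rewrite Rintegral_cst// mul1r; exact: (congr1 fine (probability_setT mu)).
move=> <-.
by apply: eq_bigr => k _; rewrite Rintegral_cst// mul1r.
Qed.

(** * Lower bound on the objective for a general [U] *)

Section LowerBound.
Context (R : realType) {d : measure_display} {U : measurableType d}.
Variables (rho D : R) (mu0 mu1 : probability U R) (g : U -> R).
Hypotheses (rho01 : 0 < rho < 1) (adm : admissible rho D mu0 mu1 g).

Let mg : measurable_fun setT g. Proof. by have [] := adm. Qed.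
Let g01 u : 0 <= g u <= 1. Proof. by have [_ + _ _] := adm; exact. Qed.

Lemma pXhU_true A : pXhU rho mu0 mu1 g true A =
  rho * (\int[mu1]_(u in A) g u) + (1 - rho) * (\int[mu0]_(u in A) g u).
Proof. by rewrite /pXhU sum_bool. Qed.

Lemma pXhU_false A : measurable A -> pXhU rho mu0 mu1 g false A =
  rho * (fine (mu1 A) - \int[mu1]_(u in A) g u)
  + (1 - rho) * (fine (mu0 A) - \int[mu0]_(u in A) g u).
Proof. by move=> mA; rewrite -!Rintegral_onem// /pXhU sum_bool. Qed.

Lemma pXU_ge0 x A : 0 <= pXU rho mu0 mu1 x A.
Proof.
have /andP[rho0 rho1] := rho01.
by rewrite mulr_ge0 ?fine_ge0//; case: x; rewrite /pX ?subr_ge0 ltW.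
Qed.

Lemma pXhU_ge0 b A : 0 <= pXhU rho mu0 mu1 g b A.
Proof.
have /andP[rho0 rho1] := rho01.
rewrite sumr_ge0// => x _; rewrite mulr_ge0//.
  by case: x; rewrite /pX ?subr_ge0 ltW.
apply: Rintegral_ge0 => u _.
by have /andP[] := g01 u; case: b; rewrite /gb ?subr_ge0.
Qed.

Lemma sum_pXU n (A : 'I_n -> set U) x : fin_partition A ->
  \sum_k pXU rho mu0 mu1 x (A k) = pX rho x.
Proof. by move=> pA; rewrite -mulr_sumr; case: x; rewrite mass_partition// mulr1. Qed.

Lemma sum_pXhU n (A : 'I_n -> set U) b : fin_partition A ->
  \sum_k pXhU rho mu0 mu1 g b (A k) = pX rho b.
Proof.
move=> pA; have [_ _ _ <-] := adm; have [mA _ _] := pA.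
case: b.
  under eq_bigr do rewrite pXhU_true.
  by rewrite big_split/= -!mulr_sumr !Rintegral_partition// pXhU_true.
under eq_bigr do rewrite pXhU_false//.
rewrite big_split/= -!mulr_sumr !sumrB !Rintegral_partition// !mass_partition//.
by rewrite pXhU_false// !probability_setT.
Qed.

(** Slabs of width [1 / n.+1]; since they are half-open, the last index [n.+1] is there to catch
    [g u = 1]. *)
Definition level_cell n (k : 'I_n.+2) : set U :=
  [set u | k%:R <= n.+1%:R * g u < k.+1%:R].

Lemma level_cell_partition n : fin_partition (@level_cell n).
Proof.
split=> [k|k l|].
- have mh : measurable_fun setT (fun u => n.+1%:R * g u) by exact: measurable_funM.
  rewrite (_ : level_cell k = setT `&` (fun u => n.+1%:R * g u) @^-1` `[k%:R, k.+1%:R[).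
    exact: mh.
  by apply/seteqP; split=> u /=; rewrite in_itv/= /level_cell/=; tauto.
- apply: contraNP => /eqP/set0P[u [/andP[ku uk] /andP[lu ul]]].
  have : (k < l.+1)%N by rewrite -(ltr_nat R) (le_lt_trans ku).
  have : (l < k.+1)%N by rewrite -(ltr_nat R) (le_lt_trans lu).
  by rewrite !ltnS => lk kl; apply/eqP/val_inj/anti_leq; rewrite lk kl.
- apply/seteqP; split=> // u _; have /andP[g0 g1] := g01 u.
  have /truncn_itv/andP[tl tr] : 0 <= n.+1%:R * g u by rewrite mulr_ge0.
  have tn : (Num.truncn (n.+1%:R * g u) < n.+2)%N.
    by rewrite ltnS -(ler_nat R) (le_trans tl)// ler_piMr.
  by exists (Ordinal tn) => //=; rewrite /level_cell/= tl.
Qed.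

(* On a cell the conditional law of [Xhat] given [U] is almost constant, so
   [X] and [Xhat] are almost independent given the cell. *)
Let cell_bound (X0 X1 g0 g1 t e : R) : 0 <= X0 -> 0 <= X1 -> 0 <= e -> 0 <= t <= 1 ->
  t * X0 <= g0 <= (t + e) * X0 -> t * X1 <= g1 <= (t + e) * X1 ->
  2 * ((X0 - 2 * g0) - (X1 - 2 * g1)) - 8 * e * (X1 + X0) <=
  (2 * (2 * t - 1) * (X1 - X0) - (2 * t - 1) ^+ 2 * (X1 + X0))
  + (2 * (2 * t - 1) * ((g1 + g0) - (X1 - g1 + (X0 - g0)))
     - (2 * t - 1) ^+ 2 * ((g1 + g0) + (X1 - g1 + (X0 - g0)))).
Proof.
move=> x0 x1 e0 /andP[t0 t1] /andP[l0 h0] /andP[l1 h1].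
(* The excesses over a channel constantly equal to [t]; the gap between the two sides is a
   nonnegative combination of them and of their slacks. *)
pose k0 := g0 - t * X0; pose k1 := g1 - t * X1.
have -> : g0 = t * X0 + k0 by rewrite /k0; ring.
have -> : g1 = t * X1 + k1 by rewrite /k1; ring.
have k00 : 0 <= k0 by rewrite /k0; lra.
have k10 : 0 <= k1 by rewrite /k1; lra.
have k0e : k0 <= e * X0 by rewrite /k0; lra.
have k1e : k1 <= e * X1 by rewrite /k1; lra.
have a0 : 0 <= t * (k0 + k1) by rewrite mulr_ge0//; lra.
rewrite -subr_ge0; set Y := (Y in 0 <= Y).
have -> : Y = 8 * (t * (k0 + k1)) + 8 * (e * X0 - k0) + 8 * (e * X1 - k1) + 8 * k0.
  by rewrite /Y; ring.
lra.
Qed.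

(** Each summand is the integral over the cell of [(1 - 2 * X) * (1 - 2 * Xhat)], so the sum is
    [1 - 2 * P(X <> Xhat)]. *)
Lemma sum_level_cell_bias n :
  \sum_k ((pXU rho mu0 mu1 false (@level_cell n k)
           - 2 * ((1 - rho) * \int[mu0]_(u in level_cell k) g u))
         - (pXU rho mu0 mu1 true (level_cell k)
           - 2 * (rho * \int[mu1]_(u in level_cell k) g u))) >= 1 - 2 * D.
Proof.
have pA := level_cell_partition n.
rewrite !sumrB !sum_pXU// -!mulr_sumr !Rintegral_partition//.
have h1 : pXXhU rho mu0 mu1 g true false setT = rho * (1 - \int[mu1]_u g u).
  rewrite -[LHS]/(rho * \int[mu1]_u (1 - g u)) Rintegral_onem//; congr (_ * (_ - _)).
  exact: (congr1 fine (probability_setT mu1)).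
have h0 : pXXhU rho mu0 mu1 g false true setT = (1 - rho) * \int[mu0]_u g u by [].
have [_ _ + _] := adm; rewrite !sum_bool h1 h0 /hamming /pX /=.
lra.
Qed.

(** On each cell [xlg_cell_ge] is applied to [X] and to [Xhat] with the same parameter, close to the
    bias of [Xhat]. The quadratic terms then nearly cancel, leaving twice the product of the biases,
    and [cell_bound] controls the error. *)
Lemma mi_level_cell_ge (a : R) n : 0 < a < 1 / 2 -> D <= 2 * a * (1 - a) ->
  2 * (Hb rho - Hb a) - 8 * (slope a / ln 2) / n.+1%:R <=
  mi_fin (fun y (k : 'I_n.+2) => pXU rho mu0 mu1 y (level_cell k))
  + mi_fin (fun y (k : 'I_n.+2) => pXhU rho mu0 mu1 g y (level_cell k)).
Proof.
move=> a02 Da; have pA := level_cell_partition n; have [mA _ _] := pA.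
have /andP[rho0 rho1] := rho01.
set c := slope a / ln 2.
have c0 : 0 <= c by rewrite divr_ge0 ?slope_ge0// ltW// ln2_gt0.
rewrite (mi_fin_bool rho01); last 2 first.
- by move=> y k; exact: pXU_ge0.
- by move=> y; exact: sum_pXU.
rewrite (mi_fin_bool rho01); last 2 first.
- by move=> y k; exact: pXhU_ge0.
- by move=> y; exact: sum_pXhU.
rewrite addrACA -big_split/=.
pose X x k := pXU rho mu0 mu1 x (@level_cell n k).
pose V x k := pXhU rho mu0 mu1 g x (@level_cell n k).
pose E k := ((X false k - 2 * ((1 - rho) * \int[mu0]_(u in level_cell k) g u))
         - (X true k - 2 * (rho * \int[mu1]_(u in level_cell k) g u))).
pose K := Hb a + c * (1 - 2 * a) ^+ 2.
have cell k : c * (2 * E k - 8 * n.+1%:R^-1 * (X true k + X false k))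
    - 2 * K * (X true k + X false k) <=
    xlg_cell (X true k) (X false k) + xlg_cell (V true k) (V false k).
  have N0 : 0 < n.+1%:R :> R by [].
  (* The lower end of the slab, an approximation of [P(Xhat = 1 | U)] within [1 / n.+1]. *)
  pose t : R := k%:R / n.+1%:R.
  have t01 : 0 <= t <= 1.
    by rewrite divr_ge0//= ler_pdivrMr// mul1r ler_nat -ltnS ltn_ord.
  have gA u : level_cell k u -> t <= g u <= t + n.+1%:R^-1.
    rewrite /level_cell/= /t -[X in _ + X]mul1r -mulrDl natr1 => /andP[lu ul].
    by rewrite ler_pdivrMr// ler_pdivlMr// mulrC lu ltW.
  have h0 := Rintegral_bounds mu0 mg g01 (mA k) gA.
  have h1 := Rintegral_bounds mu1 mg g01 (mA k) gA.
  have q1 : 0 <= 1 - rho by lra.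
  have b0 : t * X false k <= (1 - rho) * \int[mu0]_(u in level_cell k) g u
      <= (t + n.+1%:R^-1) * X false k.
    have Xz z : z * X false k = (1 - rho) * (z * fine (mu0 (level_cell k))).
      by rewrite /X /pXU /=; ring.
    by have /andP[l h] := h0; rewrite !Xz !ler_wpM2l.
  have b1 : t * X true k <= rho * \int[mu1]_(u in level_cell k) g u
      <= (t + n.+1%:R^-1) * X true k.
    have Xz z : z * X true k = rho * (z * fine (mu1 (level_cell k))).
      by rewrite /X /pXU /=; ring.
    by have /andP[l h] := h1; rewrite !Xz !ler_wpM2l ?(ltW rho0).
  have Xf := pXU_ge0 false (level_cell k); have Xt := pXU_ge0 true (level_cell k).
  have Vt := pXhU_ge0 true (level_cell k); have Vf := pXhU_ge0 false (level_cell k).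
  have n0 : 0 <= n.+1%:R^-1 :> R by rewrite invr_ge0.
  have := ler_wpM2l c0 (cell_bound Xf Xt n0 t01 b0 b1).
  have := xlg_cell_ge (2 * t - 1) a02 Xt Xf.
  have := xlg_cell_ge (2 * t - 1) a02 Vt Vf.
  rewrite -/c -/(X true k) -/(X false k) -/(V true k) -/(V false k) -/K -/(E k).
  have Ef : V false k = X true k - rho * \int[mu1]_(u in level_cell k) g u
    + (X false k - (1 - rho) * \int[mu0]_(u in level_cell k) g u).
    by rewrite /V pXhU_false// /X /pXU/=; ring.
  have Et : V true k = _ := pXhU_true (level_cell k).
  move: (xlg_cell (V _ _) _) (xlg_cell (X _ _) _) => lv lx.
  rewrite Ef Et; clear -c; clearbody c t E X.
  set i1 := rho * _; set i0 := (1 - rho) * _; set N := n.+1%:R^-1.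
  move: (X true k) (X false k) (E k) i1 i0 N => x1 x0 e i1 i0 N.
  lra.
have : \sum_k (c * (2 * E k - 8 * n.+1%:R^-1 * (X true k + X false k))
    - 2 * K * (X true k + X false k)) <= \sum_k (xlg_cell (X true k) (X false k)
    + xlg_cell (V true k) (V false k)) by apply: ler_sum => k _; exact: cell.
have sX x : \sum_k X x k = pX rho x by exact: sum_pXU.
have sE : 1 - 2 * D <= \sum_k E k by exact: sum_level_cell_bias.
rewrite -/X -/V.
move: (\sum_k (xlg_cell _ _ + _)) => S; clearbody E X.
rewrite sumrB -!mulr_sumr sumrB -!mulr_sumr big_split/= !sX /pX subrKC !mulr1 /K.
have := ler_wpM2l c0 sE; have := ler_wpM2l c0 Da; clear -c; clearbody c.
move: (Hb rho) (Hb a) (\sum_k E k) (n.+1%:R^-1) => h h' s N.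
lra.
Qed.

Lemma objective_ge (a : R) : 0 < a < 1 / 2 -> D <= 2 * a * (1 - a) ->
  ((Hb rho - Hb a)%:E <= objective rho mu0 mu1 g)%E.
Proof.
move=> a02 Da; apply/lee_addgt0Pr => e e0.
set c := slope a / ln 2.
have c0 : 0 <= c by rewrite divr_ge0 ?slope_ge0// ltW// ln2_gt0.
(* The larger of the two informations is at least their half-sum, so the error [8 * c / n.+1] is
   halved. *)
pose n := Num.truncn (4 * c / e).
have en : 4 * c / n.+1%:R <= e.
  rewrite ler_pdivrMr// [e * _]mulrC -ler_pdivrMr//.
  have ce : 0 <= 4 * c / e by exact: divr_ge0 (mulr_ge0 (ler0n R 4) c0) (ltW e0).
  by have /andP[_ /ltW] := truncn_itv ce.
have half I : 2 * (Hb rho - Hb a) - 8 * c / n.+1%:R <= I -> 2 * (Hb rho - Hb a - e) <= I.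
  move: en; clearbody c; move: (n.+1%:R^-1) (Hb rho) (Hb a) => N h h' en; lra.
have := mi_level_cell_ge n a02 Da => /half; clear half.
set I1 := mi_fin _; set I2 := mi_fin _; move: (Hb rho) (Hb a) => Hr Ha h.
have pA := level_cell_partition n.
have h1 : (I1%:E <= mi_bin_gen (pXU rho mu0 mu1))%E.
  by apply: ereal_sup_ubound; exists n.+2, (@level_cell n).
have h2 : (I2%:E <= mi_bin_gen (pXhU rho mu0 mu1 g))%E.
  by apply: ereal_sup_ubound; exists n.+2, (@level_cell n).
have [I12|I21] := leP I1 I2.
  apply: (@le_trans _ _ (I2%:E + e%:E)%E); first by rewrite -EFinD lee_fin; lra.
  by rewrite leeD2r// /objective le_max h2 orbT.
apply: (@le_trans _ _ (I1%:E + e%:E)%E); first by rewrite -EFinD lee_fin; lra.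
by rewrite leeD2r// /objective le_max h1.
Qed.

End LowerBound.

(** * Measures with two atoms, and [bool] as a Polish space *)

Section TwoPoint.
Context (R : realType) {d : measure_display} {T : measurableType d}.
Variables (x y : T) (p q : R) (p0 : 0 <= p) (q0 : 0 <= q) (pq : p + q = 1).

Definition two_point : set T -> \bar R :=
  measure_add (mscale (NngNum p0) \d_x) (mscale (NngNum q0) \d_y).

HB.instance Definition _ := Measure.on two_point.

Let two_pointE A : two_point A = (p * (x \in A)%:R + q * (y \in A)%:R)%:E.
Proof.
have -> : two_point A = (p%:E * \d_x A + q%:E * \d_y A)%E.
  by rewrite /two_point measure_addE.
by rewrite !diracE.
Qed.

Let two_point_setT : two_point setT = 1%E.
Proof. by rewrite two_pointE !in_setT !mulr1 pq. Qed.

HB.instance Definition _ := Measure_isProbability.Build _ _ _ two_point two_point_setT.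

Definition two_point_prob : probability T R := two_point.

Lemma two_point_probE A : two_point_prob A = (p * (x \in A)%:R + q * (y \in A)%:R)%:E.
Proof. exact: two_pointE. Qed.

Lemma Rintegral_two_point A (f : T -> R) : measurable A -> measurable_fun A f ->
  (forall u, 0 <= f u) ->
  \int[two_point_prob]_(u in A) f u = p * ((x \in A)%:R * f x) + q * ((y \in A)%:R * f y).
Proof.
move=> mA mf f0; rewrite /Rintegral.
have mf' : measurable_fun A (EFin \o f) by exact/measurable_EFinP.
rewrite -[X in fine X]/(\int[two_point]_(u in A) (f u)%:E)%E.
rewrite ge0_integral_measure_add//; last by move=> u _; rewrite lee_fin.
rewrite !ge0_integral_mscale//; try by move=> u _; rewrite lee_fin.
by rewrite !integral_dirac// !diracE.
Qed.

End TwoPoint.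

(** Completeness from compactness; it equips [bool] with the structure that [polish] expects. *)
Lemma bool_cauchy_cvg (F : set_system bool) : ProperFilter F -> cauchy F -> cvg F.
Proof. by move=> PF cF; apply: (compact_cauchy_cvg PF cF filterT bool_compact). Qed.

HB.instance Definition _ := Uniform_isComplete.Build bool bool_cauchy_cvg.

Lemma polish_bool (R : realType) : @polish R bool.
Proof.
split; first exact: discrete_hausdorff.
exists setT; split; first exact: countableP.
by move=> O [x Ox] _; exists x.
Qed.

Lemma measurable_borel_bool (R : realType) (A : set (@borel_of R bool)) : measurable A.
Proof. by apply: sub_sigma_algebra; exact: discrete_open. Qed.

(** * Upper bound on [varphi] by a binary [U] *)

Section Achievability.
Variables (R : realType) (rho : R).
Hypothesis rho01 : 0 < rho < 1.

(** Only cells containing an atom contribute. A partition either separates [x] from [y], giving the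
    stated value, or merges them, and then [xlg_cell_add] applies. *)
Lemma mi_bin_gen_two_point (d : measure_display) (T : measurableType d) (x y : T)
    (J : bool -> set T -> R) (v : bool -> bool -> R) :
  (forall b A, measurable A ->
     J b A = v b true * (x \in A)%:R + v b false * (y \in A)%:R) ->
  (forall b c, 0 <= v b c) -> (forall b, v b true + v b false = pX rho b) ->
  (mi_bin_gen J <= (Hb rho + xlg_cell (v true true) (v false true)
                          + xlg_cell (v true false) (v false false))%:E)%E.
Proof.
move=> JE v0 vM; apply: ge_ereal_sup => _ [n [A [pA ->]]]; rewrite lee_fin.
have [mA _ _] := pA.
have s1 z : \sum_k (z \in A k)%:R = 1 :> R.
  rewrite -[RHS](mass_partition (\d_z : probability T R) pA).
  by apply: eq_bigr => k _; rewrite -[RHS]/(fine (\d_z (A k))) diracE.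
rewrite (mi_fin_bool rho01); last 2 first.
- by move=> b k; rewrite JE// addr_ge0// mulr_ge0.
- by move=> b; under eq_bigr do rewrite JE//; rewrite big_split/= -!mulr_sumr !s1 !mulr1.
rewrite -[leRHS]addrA lerD2l.
rewrite -[leRHS](_ : \sum_k ((x \in A k)%:R * xlg_cell (v true true) (v false true)
   + (y \in A k)%:R * xlg_cell (v true false) (v false false)) = _); last first.
  by rewrite big_split/= -!mulr_suml !s1 !mul1r.
apply: ler_sum => k _; rewrite !JE//.
have x00 : xlg_cell 0 0 = 0 :> R by rewrite /xlg_cell !xlgE !mul0r addr0.
case: (x \in A k); case: (y \in A k); rewrite ?mulr1 ?mulr0 ?mul1r ?mul0r ?addr0 ?add0r ?x00//.
exact: xlg_cell_add.
Qed.

(* The optimal [U] is binary, [X] and [Xhat] being its outputs through two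
   independent binary symmetric channels of crossover probability [a]. *)
Lemma varphi_le (a q D : R) : 0 <= a <= 1 -> 0 <= q <= 1 ->
  q * (1 - a) + (1 - q) * a = rho -> 2 * a * (1 - a) <= D ->
  (varphi rho D <= (Hb rho - Hb a)%:E)%E.
Proof.
move=> /andP[a0 a1] /andP[q0 q1] qa aD; have /andP[rho0 rho1] := rho01.
pose T := @borel_of R bool.
have rn0 : rho != 0 by rewrite lt0r_neq0.
have r1n0 : 1 - rho != 0 by rewrite lt0r_neq0// subr_gt0.
have p1t : 0 <= q * (1 - a) / rho by rewrite divr_ge0 ?mulr_ge0 ?subr_ge0// ltW.
have p1f : 0 <= (1 - q) * a / rho by rewrite divr_ge0 ?mulr_ge0 ?subr_ge0// ltW.
have p0t : 0 <= q * a / (1 - rho) by rewrite divr_ge0 ?mulr_ge0 ?subr_ge0// ltW.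
have p0f : 0 <= (1 - q) * (1 - a) / (1 - rho).
  by rewrite divr_ge0 ?mulr_ge0 ?subr_ge0// ltW.
have p1E : q * (1 - a) / rho + (1 - q) * a / rho = 1 by rewrite -mulrDl qa divff.
have p0E : q * a / (1 - rho) + (1 - q) * (1 - a) / (1 - rho) = 1.
  have qa' : q * a + (1 - q) * (1 - a) = 1 - rho by rewrite -qa; ring.
  by rewrite -mulrDl qa' divff.
(* Bayes' rule: [mu1] and [mu0] are the laws of [U] given [X], where [q] is the probability that [U]
   is [true]. *)
pose mu1 : probability T R := two_point_prob (true : T) (false : T) p1t p1f p1E.
pose mu0 : probability T R := two_point_prob (true : T) (false : T) p0t p0f p0E.
pose g (u : T) : R := if (u : bool) then 1 - a else a.
have mA (A : set T) : measurable A by exact: measurable_borel_bool.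
have mf (f : T -> R) A : measurable_fun A f by move=> _ B _; exact: mA.
have gb0 b u : 0 <= gb g b u by case: b; case: u; rewrite /gb /g ?subKr ?subr_ge0.
(* The joint law of a channel output [b] and [U = c], common to [X] and [Xhat]. *)
pose v (b c : bool) := (if c then q else 1 - q) * (if b == c then 1 - a else a).
have XE b A : pXU rho mu0 mu1 b A = v b true * ((true : T) \in A)%:R
    + v b false * ((false : T) \in A)%:R.
  by case: b; rewrite /pXU /pX two_point_probE /v/=; field.
have XXhE x b A : pXXhU rho mu0 mu1 g x b A =
    v x true * (((true : T) \in A)%:R * gb g b (true : T))
    + v x false * (((false : T) \in A)%:R * gb g b (false : T)).
  rewrite /pXXhU; case: x; rewrite -[fine _]/(\int[_]_(u in A) gb g b u).
    by rewrite /mu1 Rintegral_two_point// /pX /v/=; field.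
  by rewrite /mu0 Rintegral_two_point// /pX /v/=; field.
have XhE b A : pXhU rho mu0 mu1 g b A = v b true * ((true : T) \in A)%:R
    + v b false * ((false : T) \in A)%:R.
  by rewrite /pXhU sum_bool !XXhE /v /gb /g; case: b => /=; ring.
have vM b : v b true + v b false = pX rho b.
  by case: b; rewrite /v /pX/= -qa; ring.
have v0 b c : 0 <= v b c by case: b; case: c; rewrite /v mulr_ge0 ?subr_ge0.
have vc : Hb rho + xlg_cell (v true true) (v false true)
    + xlg_cell (v true false) (v false false) = Hb rho - Hb a.
  rewrite /v/= -[X in xlg_cell _ (q * X)](subKr 1) !xlg_cell_scale Hb_symm; ring.
have obj : (objective rho mu0 mu1 g <= (Hb rho - Hb a)%:E)%E.
  by rewrite /objective ge_max -vc !(mi_bin_gen_two_point (x := true : T) (y := false : T)).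
apply: le_trans obj; apply: ereal_inf_lbound => /=.
exists bool; split; first exact: polish_bool.
exists mu0, mu1, g; split=> //; split=> //.
- by case; rewrite /g ?a0 ?a1 ?subr_ge0 ?gerBl ?a0 ?a1.
- rewrite !sum_bool !XXhE !in_setT /v /gb /g /hamming/=.
  by rewrite (le_trans _ aD)// le_eqVlt; apply/orP; left; apply/eqP; ring.
- by move=> b; rewrite XhE !in_setT !mulr1.
Qed.

End Achievability.

(** * The value of [varphi] *)

Section RateFunction.
Variables (R : realType) (rho : R).
Hypothesis rho02 : 0 < rho <= 1 / 2.

Let rho01 : 0 < rho < 1.
Proof. by have /andP[r0 r2] := rho02; apply/andP; split; lra. Qed.

(** The partition with a single cell has zero mutual information. *)
Lemma objective_ge0 (d : measure_display) (U : measurableType d)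
    (mu0 mu1 : probability U R) (g : U -> R) : (0 <= objective rho mu0 mu1 g)%E.
Proof.
rewrite /objective le_max; apply/orP; left.
pose A (k : 'I_1) : set U := setT.
have pA : fin_partition A.
  split=> [k|k l|]; [exact: measurableT|by rewrite !ord1 eqxx|].
  by apply/seteqP; split=> // u _; exists ord0.
apply: ereal_sup_ubound; exists 1, A; split=> //.
rewrite (mi_fin_bool rho01) => [|y k|y]; [|exact: pXU_ge0|exact: sum_pXU].
have E x : pXU rho mu0 mu1 x setT = pX rho x.
  by rewrite -(sum_pXU rho mu0 mu1 x pA) big_ord1.
congr _%:E; rewrite big_ord1 !E /pX.
by have := xlg_cell_scale 1 rho; rewrite !mul1r => ->; ring.
Qed.

Lemma varphi_ge D (v : R) :
  (forall (d : measure_display) (U : measurableType d) (mu0 mu1 : probability U R) g,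
     admissible rho D mu0 mu1 g -> (v%:E <= objective rho mu0 mu1 g)%E) ->
  (v%:E <= varphi rho D)%E.
Proof.
move=> H; apply: le_ereal_inf_tmp => _ [T [_ [mu0 [mu1 [g [adm ->]]]]]].
exact: H adm.
Qed.

Lemma varphiE D : 0 <= D < 2 * rho * (1 - rho) ->
  varphi rho D = (Hb rho - Hb ((1 - Num.sqrt (1 - 2 * D)) / 2))%:E.
Proof.
move=> /andP[D0 D1]; have /andP[rho0 rho2] := rho02.
set s := Num.sqrt (1 - 2 * D); set a := (1 - s) / 2.
have s2 : s ^+ 2 = 1 - 2 * D by rewrite sqr_sqrtr//; nra.
have s0 : 0 < s by rewrite sqrtr_gt0; nra.
have s1 : s <= 1 by rewrite -(@ler_pXn2r _ 2) ?nnegrE ?(ltW s0)// expr1n s2; lra.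
have sE : s = 1 - 2 * a by rewrite /a; lra.
have aD : 2 * a * (1 - a) = D by move: s2; rewrite sE; nra.
have a0 : 0 <= a by rewrite /a; lra.
have a2 : a < 1 / 2 by rewrite /a; lra.
have ar : a <= rho by rewrite leNgt; apply/negP => ra; nra.
clearbody a; apply/eqP; rewrite eq_le; apply/andP; split.
  (* This input probability is the solution [q] of [q * (1 - a) + (1 - q) * a = rho]. *)
  apply: (@varphi_le _ _ rho01 a ((rho - a) / (1 - 2 * a))) => //.
  - by apply/andP; split; lra.
  - by rewrite divr_ge0 ?ler_pdivrMr; lra.
  - by field; rewrite lt0r_neq0; lra.
  - by rewrite aD.
apply: varphi_ge => d U mu0 mu1 g adm.
move: a0; rewrite le_eqVlt => /predU1P[a0|a0]; last first.
  by apply: (objective_ge rho01 adm); rewrite ?a0 ?aD.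
apply/lee_addgt0Pr => e e0.
have [a' /andP[a'0 a'2] He] := @Hb_small R e (1 / 2) e0 ltac:(lra).
apply: (@le_trans _ _ ((Hb rho - Hb a')%:E + e%:E)%E).
  rewrite -EFinD lee_fin -a0.
  have -> : Hb 0 = 0 :> R by rewrite HbE subr0 ln1; ring.
  by lra.
rewrite leeD2r//; apply: (objective_ge rho01 adm); first by rewrite a'0.
by rewrite -aD -a0; nra.
Qed.

Lemma varphi_eq0 D : 2 * rho * (1 - rho) <= D -> varphi rho D = 0%:E.
Proof.
move=> D1; have /andP[rho0 rho2] := rho02; apply/eqP; rewrite eq_le; apply/andP; split.
  (* With [q = 0] the variable [U] is constant, and [X] and [Xhat] are independent. *)
  rewrite -(subrr (Hb rho)); apply: (@varphi_le _ _ rho01 rho 0) => //.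
  - by apply/andP; split; lra.
  - by rewrite lexx ler01.
  - by ring.
by apply: varphi_ge => *; exact: objective_ge0.
Qed.

End RateFunction.

Theorem theorem7 (R : realType) (rho D : R) :
  0 < rho <= 1 / 2 ->
  (0 <= D < 2 * rho * (1 - rho) ->
     phi rho D =
       (2 * Hb rho
        + xlg ((2 - 2 * rho - D) / 2) ((2 - 2 * rho - D) / 2)
        + xlg D (D / 2)
        + xlg ((2 * rho - D) / 2) ((2 * rho - D) / 2))%:E
     /\ varphi rho D = (Hb rho - Hb ((1 - Num.sqrt (1 - 2 * D)) / 2))%:E)
  /\
  (2 * rho * (1 - rho) <= D -> phi rho D = 0%:E /\ varphi rho D = 0%:E).
Proof.
move=> rho02; split=> HD; last by rewrite phi_eq0// varphi_eq0.
split; last exact: varphiE.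
rewrite phiE// /mi_symm; congr _%:E.
have -> : (2 - 2 * rho - D) / 2 = 1 - rho - D / 2 by field.
have -> : (2 * rho - D) / 2 = rho - D / 2 by field.
(* The two off-diagonal cells of mass [D / 2] combine into [xlg D (D / 2)]. *)
by congr (_ + _ + _); rewrite !xlgE; field; rewrite lt0r_neq0// ln2_gt0.
Qed.
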